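(* Let $\alpha_0=\frac12$, which is the positive root of the equation $4\alpha\,\Gamma(\alpha+1)=\sqrt{\pi}\,\Gamma(\alpha+\frac12)$. For every $\alpha\in[0,\alpha_0]\cup[\frac32,\infty)$ and every $z\in\Delta$, $\operatorname{Re}\big(\mathtt{S}_\alpha(z)\big)>0$.
   Context: $\Delta=\{z\in\mathbb{C}:|z|<1\}$. For $\alpha>-\frac12$, $\mathtt{S}_\alpha$ is the Bessel-Struve kernel function (with parameter $\lambda=1$), $$\mathtt{S}_{\alpha}(z)=\sum_{n=0}^\infty \frac{\Gamma(\alpha+1)\,\Gamma\left(\frac{n+1}{2}\right)}{\sqrt{\pi}\,n!\,\Gamma\left(\frac n2+\alpha+1\right)} z^n .$$ *)

(* Defs.v *)
From mathcomp Require Import all_boot all_order all_algebra.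
From mathcomp Require Import complex.
From mathcomp Require Import all_classical all_reals all_analysis.

Set Implicit Arguments.
Unset Strict Implicit.
Unset Printing Implicit Defensive.

Import Order.TTheory GRing.Theory Num.Theory.
Import numFieldNormedType.Exports.

Local Open Scope classical_set_scope.
Local Open Scope complex_scope.
Local Open Scope ring_scope.

(* Euler's second integral; it converges, and hence is the Gamma function,
   for 0 < x.  All arguments used below are positive when - 2^-1 < alpha. *)
Definition Gamma (R : realType) (x : R) : R :=
  \int[lebesgue_measure]_(t in `]0, +oo[) (t `^ (x - 1) * expR (- t)).

Definition bessel_struve_coef (R : realType) (alpha : R) (n : nat) : R :=
  Gamma (alpha + 1) * Gamma (n.+1%:R / 2)
  / (Num.sqrt pi * n`!%:R * Gamma (n%:R / 2 + alpha + 1)).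

(* The norm topology is available on the alias R[i]^o rather than on R[i].
   Were the series divergent, [limn] would return the default value 0. *)
Definition bessel_struve (R : realType) (alpha : R) (z : R[i]) : R[i] :=
  limn (series (fun n => (bessel_struve_coef alpha n)%:C * z ^+ n : R[i]^o)).

(* Main.v *)
Require Import Defs.
From mathcomp Require Import all_boot all_order all_algebra.
From mathcomp Require Import complex.
From mathcomp Require Import all_classical all_reals all_analysis.
From mathcomp Require Import measurable_realfun ring lra.
Import Order.TTheory GRing.Theory Num.Theory.
Import numFieldNormedType.Exports.

Set Implicit Arguments.
Unset Strict Implicit.
Unset Printing Implicit Defensive.

Local Open Scope classical_set_scope.
Local Open Scope complex_scope.
Local Open Scope ring_scope.

(* Log-convexity of Gamma says that Gamma (x + h) / Gamma x is nondecreasing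
   in x. Applied with h = 1/2 it settles the equation for alpha0: comparing
   with the values at 1/2, 1 and 3/2, the quotient of the two sides is at most
   2 alpha for alpha < 1/2 and at least 2 alpha for alpha > 1/2. Applied with
   h = n/2 it shows that, for alpha >= 0, the n-th coefficient of S_alpha is at
   most its value b_n at alpha = 0. Since b_0 = 1, b_1 = 2 / pi and
   b_(n+2) = b_n / (n+2)^2, the sum of all b_n is less than 2, whence
   Re S_alpha(z) >= 1 - sum_(n >= 1) b_n > 0 on the whole unit disk. *)

(** * Exhaustion of the half-line by compact windows *)

(* The substitution [t = s ^+ 2] maps the windows with [k = 0] onto those with
   [k = 1]. *)
Definition pos_window (R : realType) (k n : nat) : set R :=
  `[n.+1%:R ^- k.+1, n.+1%:R ^+ k.+1].

Arguments pos_window : clear implicits.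

(** Monotone convergence: the windows increase and their union is the open half-line. *)
Lemma cvg_integral_pos_window (R : realType) (f : R -> R) (k : nat) :
  (forall t, 0 < t -> 0 <= f t) ->
  measurable_fun (`]0%R, +oo[ : set R) f ->
  (\int[lebesgue_measure]_(t in pos_window R k n) (f t)%:E)%E @[n --> \oo] -->
  (\int[lebesgue_measure]_(t in `]0%R, +oo[) (f t)%:E)%E.
Proof.
move=> f0 mf.
pose F := pos_window R k.
have F0 n : F n `<=` `]0%R, +oo[.
  move=> t; rewrite /F /pos_window /= !in_itv/= andbT => /andP[+ _].
  by apply: lt_le_trans; rewrite invr_gt0 exprn_gt0.
have <- : \bigcup_n F n = `]0%R, +oo[%classic.
  apply/seteqP; split; first by move=> t [n _]; apply: F0.
  move=> t; rewrite /= in_itv/= andbT => t0.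
  (* This index makes [m + 1] exceed both [t] and [t^-1], which places [t] between the two ends of
     the window. *)
  pose m := maxn (Num.truncn t) (Num.truncn t^-1).
  have tm : t < m.+1%:R.
    by apply: lt_le_trans (truncnS_gt t) _; rewrite ler_nat ltnS leq_maxl.
  have tVm : t^-1 < m.+1%:R.
    by apply: lt_le_trans (truncnS_gt _) _; rewrite ler_nat ltnS leq_maxr.
  have mk : m.+1%:R <= m.+1%:R ^+ k.+1 :> R.
    by rewrite exprS ler_peMr// exprn_ege1// ler1n.
  exists m => //; rewrite /F /pos_window /= in_itv/= (ltW (lt_le_trans tm mk)) andbT.
  rewrite invf_ple ?posrE ?exprn_gt0//.
  exact: ltW (lt_le_trans tVm mk).
apply: ge0_nondecreasing_set_cvg_integral.
- apply/nondecreasing_seqP => n; apply/subsetPset => t.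
  rewrite /F /pos_window /= !in_itv/= => /andP[h1 h2].
  have mk : n.+1%:R ^+ k.+1 <= n.+2%:R ^+ k.+1 :> R.
    by rewrite lerXn2r ?nnegrE// ler_nat.
  rewrite (le_trans h2 mk) andbT (le_trans _ h1)//.
  by rewrite lef_pV2 ?posrE ?exprn_gt0.
- by move=> n; exact: measurable_itv.
- by move=> n; apply/measurable_EFinP; apply: measurable_funS mf => //.
- by move=> n t /F0; rewrite /= in_itv/= andbT lee_fin => /f0.
Qed.

(** * Regularity, primitive and decay of the integrand *)

Lemma continuous_powR_gt0 (R : realType) (p t : R) : 0 < t ->
  {for t, continuous (@powR R ^~ p)}.
Proof.
move=> t0; apply: differentiable_continuous; apply/derivable1_diffP.
by apply: derivable_powR; rewrite in_itv/= t0.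
Qed.

Lemma continuous_powR_expRN (R : realType) (p t : R) : 0 < t ->
  {for t, continuous (fun t => t `^ p * expR (- t))}.
Proof.
move=> t0; apply: (@continuousM R); first exact: continuous_powR_gt0.
by apply: continuous_comp; [exact: opp_continuous|exact: continuous_expR].
Qed.

Lemma measurable_powR_expRN (R : realType) (p : R) (D : set R) :
  measurable_fun D (fun t => t `^ p * expR (- t)).
Proof.
apply: measurable_funTS; apply: measurable_funM; first exact: measurable_powR.
by apply: measurableT_comp.
Qed.

Lemma within_continuous_pos (R : realType) (f : R -> R) (a b : R) : 0 < a ->
  (forall t, 0 < t -> {for t, continuous f}) -> {within `[a, b], continuous f}.
Proof.
move=> a0 cf; apply: continuous_in_subspaceT => t.
rewrite inE/= in_itv/= => /andP[at_ _]; apply: cf; exact: lt_le_trans at_.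
Qed.

Lemma integral_powR_expRN (R : realType) (x a b : R) : 0 < a < b ->
  (\int[lebesgue_measure]_(t in `[a, b])
    (x * (t `^ (x - 1) * expR (- t)) - t `^ x * expR (- t))%:E =
  (b `^ x * expR (- b) - a `^ x * expR (- a))%:E)%E.
Proof.
move=> /andP[a0 ab]; rewrite EFinB.
apply: (@continuous_FTC2 R _ (fun t => t `^ x * expR (- t))) => //.
- apply: within_continuous_pos a0 _ => t t0.
  apply: (@continuousB R R^o); last exact: continuous_powR_expRN.
  by apply: (@continuousM R); [exact: cst_continuous|exact: continuous_powR_expRN].
- split.
  + move=> t; rewrite in_itv/= => /andP[at_ _].
    have t0 := lt_trans a0 at_.
    apply: derivableM; first by apply: derivable_powR; rewrite in_itv/= t0.
    exact: ex_derive.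
  + by apply: cvg_at_right_filter; exact: continuous_powR_expRN.
  + apply: cvg_at_left_filter; apply: continuous_powR_expRN.
    exact: lt_trans ab.
- move=> t; rewrite in_itv/= => /andP[at_ _].
  have t0 := lt_trans a0 at_.
  have t0' : t \in `]0, +oo[%R by rewrite in_itv/= t0.
  rewrite derive1E deriveM; last 2 first.
  + exact: derivable_powR.
  + exact: ex_derive.
  rewrite -!derive1E powR_derive1// derive1_comp// derive1N// derive1_id.
  rewrite derive1E.
  have /funeqP -> := @derive_expR R.
  rewrite /GRing.scale/=; ring.
Qed.

(** Raise [u <= 1 + u <= expR u], with [u = t / (2 * x)], to the power [x]. *)
Lemma powR_le_expR_half (R : realType) (x t : R) : 0 < x -> 0 <= t ->
  t `^ x <= (2 * x) `^ x * expR (t / 2).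
Proof.
move=> x0 t0.
have -> : expR (t / 2) = expR (t / (2 * x)) `^ x.
  by rewrite -expRM; congr expR; field; rewrite gt_eqF.
rewrite -powRM ?expR_ge0 ?mulr_ge0 ?(ltW x0)//.
apply: ge0_ler_powR; rewrite ?nnegrE ?mulr_ge0 ?expR_ge0 ?(ltW x0)//.
rewrite -ler_pdivrMl ?mulr_gt0// mulrC.
have := expR_ge1Dx (t / (2 * x)); apply: le_trans; lra.
Qed.

(** Split [expR (- t)] into two equal factors: one absorbs the power, the other tends to 0. *)
Lemma powR_expRN_cvgy (R : realType) (x : R) : 0 <= x ->
  t `^ x * expR (- t) @[t --> +oo] --> (0 : R).
Proof.
move=> x0.
have half : expR (- (t / 2)) @[t --> +oo] --> (0 : R).
  apply: (cvg_comp (fun t : R => t / 2) (fun t => expR (- t))); last exact: cvgr_expR.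
  by apply: gt0_cvgMly; rewrite ?invr_gt0//; exact: cvg_id.
pose C := if x == 0 then 1 else (2 * x) `^ x.
apply: (@squeeze_cvgr _ _ _ _ (fun=> 0) (fun t => C * expR (- (t / 2)))).
- near=> t.
  have t0 : 0 <= t by near: t; exact: nbhs_pinfty_ge.
  rewrite mulr_ge0 ?powR_ge0 ?expR_ge0//=.
  have -> : - t = - (t / 2) + - (t / 2) by lra.
  rewrite expRD mulrA ler_wpM2r ?expR_ge0//.
  rewrite expRN ler_pdivrMr ?expR_gt0// /C.
  case: eqP => [->|/eqP xn0].
    by rewrite powRr0 mul1r -expR0 ler_expR divr_ge0.
  by apply: powR_le_expR_half => //; rewrite lt_neqAle eq_sym xn0.
- exact: cvg_cst.
- by rewrite -(mulr0 C); apply: cvgM => //; exact: cvg_cst.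
Unshelve. all: by end_near. Qed.

(** * The Gamma integral: functional equation and values at 1 and 1/2 *)

(** Kept in the extended reals, so that convergence can be stated as finiteness; [Gamma] is its
    [fine] part, which would be 0 for an infinite integral. *)
Definition gamma_int (R : realType) (x : R) : \bar R :=
  (\int[lebesgue_measure]_(t in `]0%R, +oo[) (t `^ (x - 1) * expR (- t))%:E)%E.

Lemma GammaE (R : realType) (x : R) : Gamma x = fine (gamma_int x).
Proof. by []. Qed.

Lemma gamma_int_ge0 (R : realType) (x : R) : (0 <= gamma_int x)%E.
Proof.
by apply: integral_ge0 => t _; rewrite lee_fin mulr_ge0 ?powR_ge0 ?expR_ge0.
Qed.

Lemma Gamma_EFin (R : realType) (x : R) : (gamma_int x < +oo)%E ->
  gamma_int x = (Gamma x)%:E.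
Proof. by move=> h; rewrite GammaE fineK// ge0_fin_numE// gamma_int_ge0. Qed.

Lemma cvg_gamma_int (R : realType) (k : nat) (x : R) :
  (\int[lebesgue_measure]_(t in pos_window R k n)
     (t `^ (x - 1) * expR (- t))%:E)%E @[n --> \oo] --> gamma_int x.
Proof.
apply: cvg_integral_pos_window.
  by move=> t t0; rewrite mulr_ge0 ?powR_ge0 ?expR_ge0.
exact: measurable_powR_expRN.
Qed.

Lemma pos_window_lt (R : realType) (k n : nat) : (0 < n)%N ->
  0 < (n.+1%:R ^- k.+1 : R) < n.+1%:R ^+ k.+1.
Proof.
move=> n0; rewrite invr_gt0 exprn_gt0//=.
have n1 : 1 < n.+1%:R ^+ k.+1 :> R by rewrite exprn_egt1// ltr1n.
by rewrite (lt_trans _ n1)// invf_lt1// exprn_gt0.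
Qed.

Lemma integrable_powR_expRN_window (R : realType) (k n : nat) (p : R) :
  (lebesgue_measure : {measure set (measurableTypeR R) -> \bar R}).-integrable (pos_window R k n)
    (EFin \o (fun t => t `^ p * expR (- t))).
Proof.
apply: continuous_compact_integrable; first exact: segment_compact.
apply: within_continuous_pos; last by move=> t; exact: continuous_powR_expRN.
by rewrite invr_gt0 exprn_gt0.
Qed.

(** Integration by parts on a window, where every integral is finite and can be moved across the
    subtraction. At [n = 0] the window would shrink to the point 1. *)
Lemma integral_powR_expRN_window (R : realType) (k n : nat) (x : R) :
  (0 < n)%N ->
  (\int[lebesgue_measure]_(t in pos_window R k n)
     (t `^ (x + 1 - 1) * expR (- t))%:E =
   x%:E * \int[lebesgue_measure]_(t in pos_window R k n)
     (t `^ (x - 1) * expR (- t))%:E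
   - ((n.+1%:R ^+ k.+1) `^ x * expR (- (n.+1%:R ^+ k.+1))
      - (n.+1%:R ^- k.+1) `^ x * expR (- (n.+1%:R ^- k.+1)))%:E)%E.
Proof.
move=> n0; rewrite -integral_powR_expRN; last exact: pos_window_lt.
have mW : measurable (pos_window R k n : set (measurableTypeR R)) by exact: measurable_itv.
have i1 := @integrable_powR_expRN_window R k n (x - 1).
have i2 := @integrable_powR_expRN_window R k n (x + 1 - 1).
have i3 := @integrable_powR_expRN_window R k n x.
have i1x := integrableZl mW x i1.
rewrite -integralZl//.
under [X in (_ - X)%E]eq_integral do rewrite EFinB EFinM.
rewrite [X in (_ - X)%E]integralB//.
rewrite addrK fin_num_oppeB ?integrable_fin_num//.
by rewrite addeA subee ?integrable_fin_num// add0e.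
Qed.

Lemma cvg_window_ub (R : realType) (k : nat) :
  (n.+1%:R ^+ k.+1 : R) @[n --> \oo] --> +oo.
Proof.
apply/cvgryPge => A; near=> n.
rewrite exprS (@le_trans _ _ n.+1%:R)//.
  by apply: (@le_trans _ _ n%:R); [near: n; exact: nbhs_infty_ger|rewrite ler_nat].
by rewrite ler_peMr// exprn_ege1// ler1n.
Unshelve. all: by end_near. Qed.

Arguments cvg_window_ub : clear implicits.

Lemma cvg_window_lb (R : realType) (k : nat) :
  (n.+1%:R ^- k.+1 : R) @[n --> \oo] --> 0.
Proof.
have n0 : \forall n \near \oo, 0 < n.+1%:R ^+ k.+1 :> R.
  by near=> n; rewrite exprn_gt0.
exact: (gtr0_cvgV0 n0).2 (cvg_window_ub R k).
Unshelve. all: by end_near. Qed.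

Lemma gamma_intS (R : realType) (x : R) : 0 < x -> (gamma_int x < +oo)%E ->
  gamma_int (x + 1) = (x%:E * gamma_int x)%E.
Proof.
move=> x0 gx; apply: (cvg_unique (@ereal_hausdorff R) (@cvg_gamma_int R 0 (x + 1))).
pose u n : R := n.+1%:R ^- 1; pose v n : R := n.+1%:R ^+ 1.
(* The two zeros are the limits of the boundary terms at the upper and at the lower end. *)
have -> : (x%:E * gamma_int x = x%:E * gamma_int x - (0 - 0)%:E)%E.
  by rewrite subrr sube0.
have h : (x%:E * \int[lebesgue_measure]_(t in pos_window R 0 n)
     (t `^ (x - 1) * expR (- t))%:E - (v n `^ x * expR (- v n)
      - u n `^ x * expR (- u n))%:E)%E @[n --> \oo] --> (x%:E * gamma_int x - (0 - 0)%:E)%E.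
  apply: cvgeB.
  - by rewrite fin_num_adde_defl.
  - apply: cvgeZl => //; exact: cvg_gamma_int.
  apply: cvg_EFin; first by near=> n.
  apply: (@cvgB R R^o).
    apply: (cvg_comp v (fun t => t `^ x * expR (- t))); first exact: cvg_window_ub.
    exact: powR_expRN_cvgy (ltW x0).
  have /cvg_at_rightP : (t `^ x * expR (- t) : R) @[t --> 0^'+] --> 0.
    rewrite -[X in _ --> X](mul0r (expR (- 0))); apply: cvgM; first exact: powR_cvg0.
    apply: cvg_at_right_filter; apply: (@continuous_comp _ _ _ -%R expR).
      exact: opp_continuous.
    exact: continuous_expR.
  apply; split; last exact: cvg_window_lb.
  by move=> n; rewrite invr_gt0 exprn_gt0.
apply: cvg_trans h; apply: near_eq_cvg; near=> n.
apply: esym; apply: integral_powR_expRN_window.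
by near: n; exact: nbhs_infty_gt.
Unshelve. all: by end_near. Qed.

(** At [x = 0] the window identity leaves only its boundary terms, which tend to [1 - 0]. *)
Lemma gamma_int1 (R : realType) : gamma_int (1 : R) = 1%E.
Proof.
apply: (cvg_unique (@ereal_hausdorff R) (@cvg_gamma_int R 0 1)).
pose u n : R := n.+1%:R ^- 1; pose v n : R := n.+1%:R ^+ 1.
have h : (expR (- u n) - expR (- v n))%:E @[n --> \oo] --> (1 - 0 : R)%:E.
  apply: cvg_EFin; first by near=> n.
  apply: (@cvgB R R^o); last first.
    by apply: (cvg_comp v (fun t => expR (- t))); [exact: cvg_window_ub|exact: cvgr_expR].
  rewrite -[X in _ --> X]expR0 -oppr0.
  apply: (@cvg_comp _ _ _ (fun n => - u n) expR _ (nbhs (- 0)));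
    last exact: continuous_expR.
  by apply: (@cvgN R R^o); exact: cvg_window_lb.
rewrite subr0 in h.
apply: cvg_trans h; apply: near_eq_cvg; near=> n.
have n0 : (0 < n)%N by near: n; exact: nbhs_infty_gt.
have := @integral_powR_expRN_window R 0 n 0 n0.
rewrite mul0e !powRr0 !mul1r add0r => ->.
by rewrite sub0e -EFinN opprB.
Unshelve. all: by end_near. Qed.

Lemma integral0y_gauss_fun (R : realType) :
  (2%:E * \int[lebesgue_measure]_(s in `]0%R, +oo[) (gauss_fun s)%:E
   = (Num.sqrt pi : R)%:E)%E.
Proof.
rewrite -integralT_gauss ge0_symfun_integralT; last 3 first.
- by move=> x; exact: gauss_fun_ge0.
- exact: continuous_gauss_fun.
- by move=> x/=; rewrite /gauss_fun sqrrN.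
congr (_ * _)%E; rewrite integral_itv_obnd_cbnd.
  congr integral; apply/seteqP; split => x /=; rewrite ?in_itv/= ?andbT//.
by apply/measurable_EFinP/measurable_funTS; exact: measurable_gauss_fun.
Qed.

(** The substitution [t = s ^+ 2] turns the integrand into twice the Gaussian. It is carried out on
    compact windows, away from the singularity at 0. *)
Lemma gamma_int_half (R : realType) : gamma_int (2^-1 : R) = (Num.sqrt pi)%:E.
Proof.
apply: (cvg_unique (@ereal_hausdorff R) (@cvg_gamma_int R 1 2^-1)).
rewrite -integral0y_gauss_fun.
have h : (2%:E * \int[lebesgue_measure]_(s in pos_window R 0 n) (gauss_fun s)%:E)%E
    @[n --> \oo] -->
    (2%:E * \int[lebesgue_measure]_(s in `]0%R, +oo[) (gauss_fun s)%:E : \bar R)%E.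
  apply: cvgeZl => //; apply: cvg_integral_pos_window.
    by move=> t _; exact: gauss_fun_ge0.
  by apply: measurable_funTS; exact: measurable_gauss_fun.
apply: cvg_trans h; apply: near_eq_cvg; near=> n.
have n0 : (0 < n)%N by near: n; exact: nbhs_infty_gt.
have /andP[a0 ab] := @pos_window_lt R 0 n n0.
rewrite /pos_window.
have -> : n.+1%:R ^- 2 = (n.+1%:R ^- 1) ^+ 2 :> R by rewrite exprVn.
rewrite -[n.+1%:R ^+ 2]/((n.+1%:R ^+ 1) ^+ 2 : R).
move: a0 ab; set a : R := n.+1%:R ^- 1; set b : R := n.+1%:R ^+ 1 => a0 ab.
have dF : derive1 (fun s : R => s ^+ 2) = (fun s => 2 * s).
  by apply/funext => s; rewrite exp_derive1 /= expr1.
have cF : continuous (fun s : R => 2 * s) by exact: mulrl_continuous.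
rewrite (@integration_by_substitution_increasing _ (fun s => s ^+ 2)
  (fun t => t `^ (2^-1 - 1) * expR (- t))) ?dF ?(ltW ab)//.
- rewrite -ge0_integralZl_EFin//; last 2 first.
  + by move=> s _; rewrite lee_fin gauss_fun_ge0.
  + by apply/measurable_EFinP/measurable_funTS; exact: measurable_gauss_fun.
  apply: eq_integral => s; rewrite inE/= in_itv/= => /andP[as_ _].
  have s0 := lt_le_trans a0 as_.
  rewrite /= -EFinM; congr EFin.
  change (2 * gauss_fun s =
    (s ^+ 2) `^ (2^-1 - 1) * expR (- s ^+ 2) * (2 * s) :> R).
  have -> : (s ^+ 2) `^ (2^-1 - 1) = s^-1.
    rewrite -powR_mulrn ?(ltW s0)// -powRrM.
    by rewrite (_ : 2 * (2^-1 - 1) = -1) ?powR_inv1 ?(ltW s0)//; lra.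
  by rewrite /gauss_fun; field; rewrite gt_eqF.
- move=> x y; rewrite !in_itv/= => /andP[ax _] /andP[ay _] xy.
  by rewrite ltrXn2r// ?nnegrE ?(ltW (lt_le_trans a0 _)).
- by apply: cvgP; apply: cvg_at_right_filter; exact: cF.
- by apply: cvgP; apply: cvg_at_left_filter; exact: cF.
- split.
  + by move=> s _; exact: ex_derive.
  + by apply: cvg_at_right_filter; exact: exprn_continuous.
  + by apply: cvg_at_left_filter; exact: exprn_continuous.
- apply: within_continuous_pos; first by rewrite exprn_gt0.
  by move=> t; exact: continuous_powR_expRN.
Unshelve. all: by end_near. Qed.

(** * Convergence and positivity of Gamma from 1/2 on *)

Lemma measurable_EFin_powR_expRN (R : realType) (p : R) (D : set R) :
  measurable_fun (D : set (measurableTypeR R))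
    (fun t => (t `^ p * expR (- t))%:E).
Proof. by apply/measurable_EFinP; exact: measurable_powR_expRN. Qed.

Lemma gamma_int_natS_lty (R : realType) (n : nat) :
  (gamma_int (n.+1%:R : R) < +oo)%E.
Proof.
elim: n => [|n IHn]; first by rewrite gamma_int1 ltry.
by rewrite -natr1 gamma_intS// lte_mul_pinfty// lee_fin.
Qed.

(** The integrand is at most the one for 1/2 when [t <= 1] and the one for an integer above [x] when
    [t > 1], hence at most their sum. The range suffices: for [alpha >= 0] every Gamma argument in
    the coefficients is at least 1/2. *)
Lemma gamma_int_lty (R : realType) (x : R) : 2^-1 <= x -> (gamma_int x < +oo)%E.
Proof.
move=> x2; pose n := Num.truncn x.
have xn : x <= n.+1%:R by apply: ltW; exact: truncnS_gt.
have : (gamma_int (2^-1 : R) + gamma_int (n.+1%:R : R) < +oo)%E.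
  by rewrite gamma_int_half lte_add_pinfty ?ltry// gamma_int_natS_lty.
apply: le_lt_trans; rewrite /gamma_int -ge0_integralD//; first last.
- exact: measurable_EFin_powR_expRN.
- by move=> t _; rewrite lee_fin mulr_ge0 ?powR_ge0 ?expR_ge0.
- exact: measurable_EFin_powR_expRN.
- by move=> t _; rewrite lee_fin mulr_ge0 ?powR_ge0 ?expR_ge0.
apply: ge0_le_integral => //.
- by move=> t _; rewrite lee_fin mulr_ge0 ?powR_ge0 ?expR_ge0.
- exact: measurable_EFin_powR_expRN.
- by apply: emeasurable_funD; exact: measurable_EFin_powR_expRN.
move=> t /=; rewrite in_itv/= andbT => t0.
rewrite -EFinD lee_fin -mulrDl ler_wpM2r ?expR_ge0//.
have [t1|t1] := leP t 1.
  apply: (@le_trans _ _ (t `^ (2^-1 - 1))); last by rewrite lerDl powR_ge0.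
  by apply: ger_powR; [rewrite t0|rewrite lerD2r].
apply: (@le_trans _ _ (t `^ (n.+1%:R - 1))); last by rewrite lerDr powR_ge0.
by apply: ler_powR; [exact: ltW|rewrite lerD2r].
Qed.

Lemma integrable_Gamma (R : realType) (x : R) : 2^-1 <= x ->
  (lebesgue_measure : {measure set (measurableTypeR R) -> \bar R}).-integrable
    `]0, +oo[ (EFin \o (fun t => t `^ (x - 1) * expR (- t))).
Proof.
move=> /gamma_int_lty gx; apply/integrableP; split.
  exact: measurable_EFin_powR_expRN.
apply: le_lt_trans gx; rewrite le_eqVlt; apply/orP; left; apply/eqP.
apply: eq_integral => t _ /=.
by rewrite ger0_norm// mulr_ge0 ?powR_ge0 ?expR_ge0.
Qed.

Lemma GammaS (R : realType) (x : R) : 2^-1 <= x -> Gamma (x + 1) = x * Gamma x.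
Proof.
move=> x2; have x0 : 0 < x by lra.
have gx := gamma_int_lty x2.
have gx1 : (gamma_int (x + 1) < +oo)%E by apply: gamma_int_lty; lra.
by apply: EFin_inj; rewrite EFinM -!Gamma_EFin// gamma_intS.
Qed.

Lemma Gamma1 (R : realType) : Gamma (1 : R) = 1.
Proof. by rewrite GammaE gamma_int1. Qed.

Lemma Gamma_half (R : realType) : Gamma (2^-1 : R) = Num.sqrt pi.
Proof. by rewrite GammaE gamma_int_half. Qed.

Lemma Gamma_gt0 (R : realType) (x : R) : 2^-1 <= x -> 0 < Gamma x.
Proof.
move=> x2; rewrite -lte_fin -Gamma_EFin ?gamma_int_lty//.
have : (0 < (expR (- 2) / 2)%:E * (lebesgue_measure (`[1%R, 2%R] : set R) : \bar R))%E.
  rewrite lebesgue_measure_itv/= lte_fin ltr1n -EFinM lte_fin.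
  by rewrite mulr_gt0 ?divr_gt0 ?expR_gt0//; lra.
move=> /lt_le_trans; apply; rewrite -integral_cst//.
apply: (@le_trans _ _ (\int[lebesgue_measure]_(t in `[1%R, 2%R]) (t `^ (x - 1) * expR (- t))%:E)%E).
  apply: ge0_le_integral => //.
  - by move=> t _; rewrite lee_fin divr_ge0 ?expR_ge0.
  - exact: measurable_EFin_powR_expRN.
  move=> t /=; rewrite in_itv/= => /andP[t1 t2]; rewrite lee_fin mulrC.
  apply: ler_pM; rewrite ?invr_ge0 ?expR_ge0 ?ler_expR ?lerN2//.
  apply: (@le_trans _ _ (t `^ (- 1))).
    by rewrite powR_inv1 ?lef_pV2 ?posrE//; lra.
  by apply: ler_powR => //; lra.
apply: ge0_subset_integral => //.
- exact: measurable_EFin_powR_expRN.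
- by move=> t _; rewrite lee_fin mulr_ge0 ?powR_ge0 ?expR_ge0.
- by move=> t /=; rewrite !in_itv/= andbT => /andP[t1 _]; lra.
Qed.

(** * Log-convexity of Gamma and the equation for alpha0 *)

(** Both factors are nondecreasing in [t] and vanish at [t = c], so their signs agree. *)
Lemma powR_sub_mul_ge0 (R : realType) (t c h d : R) :
  0 <= t -> 0 <= c -> 0 <= h -> 0 <= d ->
  0 <= (t `^ h - c `^ h) * (t `^ d - c `^ d).
Proof.
move=> t0 c0 h0 d0; have [tc|/ltW ct] := leP t c.
  by rewrite mulr_le0// subr_le0 ge0_ler_powR.
by rewrite mulr_ge0// subr_ge0 ge0_ler_powR.
Qed.

(* With [c `^ h = Gamma (x + h) / Gamma x] and [d = y - x], integrate
   [t `^ (x - 1) * expR (- t) * (t `^ h - c `^ h) * (t `^ d - c `^ d) >= 0]: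
   the two terms carrying the factor [c `^ d] cancel. *)
Lemma Gamma_mul_le (R : realType) (x y h : R) :
  2^-1 <= x -> x <= y -> 0 <= h ->
  Gamma (x + h) * Gamma y <= Gamma x * Gamma (y + h).
Proof.
(* The case [h = 0] is treated apart because [c] below is a power with exponent [h^-1]. *)
move=> x2 xy; rewrite le_eqVlt => /predU1P[<-|h0]; first by rewrite !addr0.
pose d := y - x; have d0 : 0 <= d by rewrite subr_ge0.
pose q := Gamma (x + h) / Gamma x; pose c := q `^ h^-1.
have Gx := Gamma_gt0 x2.
have q0 : 0 < q by rewrite divr_gt0// Gamma_gt0//; lra.
have ch : c `^ h = q by rewrite /c -powRrM mulVf ?gt_eqF// powRr1// ltW.
pose g z (t : R) := t `^ (z - 1) * expR (- t).
have ig z : 2^-1 <= z ->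
    (lebesgue_measure : {measure set (measurableTypeR R) -> \bar R}).-integrable
    `]0, +oo[ (EFin \o g z) by exact: integrable_Gamma.
have iZ a (f : R -> R) :
    (lebesgue_measure : {measure set (measurableTypeR R) -> \bar R}).-integrable
      `]0, +oo[ (EFin \o f) ->
    (lebesgue_measure : {measure set (measurableTypeR R) -> \bar R}).-integrable
      `]0, +oo[ (EFin \o (fun t => a * f t)).
  move=> fi; rewrite (_ : _ \o _ = (fun t => a%:E * (f t)%:E))%E//.
  exact: (integrableZl _ a fi).
pose G z w t := g z t - q * g w t.
have iG z w : 2^-1 <= z -> 2^-1 <= w ->
    (lebesgue_measure : {measure set (measurableTypeR R) -> \bar R}).-integrable
    `]0, +oo[ (EFin \o G z w).
  move=> z2 w2.
  rewrite (_ : _ \o _ = (EFin \o g z) \- (fun t => q%:E * (g w t)%:E))%E//.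
  apply: integrableB => //; first exact: ig.
  by apply: iZ; exact: ig.
have EG z w : 2^-1 <= z -> 2^-1 <= w ->
    \int[lebesgue_measure]_(t in `]0, +oo[) G z w t = Gamma z - q * Gamma w.
  move=> z2 w2; rewrite RintegralB//; last 2 first.
  - exact: ig.
  - by apply: iZ; exact: ig.
  by rewrite RintegralZl//; exact: ig.
have : 0 <= \int[lebesgue_measure]_(t in `]0, +oo[)
    (G (y + h) y t - c `^ d * G (x + h) x t).
  apply: Rintegral_ge0 => t /=; rewrite in_itv/= andbT => t0.
  have -> : G (y + h) y t - c `^ d * G (x + h) x t =
      t `^ (x - 1) * expR (- t) * ((t `^ h - c `^ h) * (t `^ d - c `^ d)).
    have tE u v : t `^ (u + v) = t `^ u * t `^ v.
      by rewrite powRD// (gt_eqF t0) implybT.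
    rewrite /G /g ch.
    have -> : y + h - 1 = (x - 1) + (h + d) by rewrite /d; ring.
    have -> : y - 1 = (x - 1) + d by rewrite /d; ring.
    have -> : x + h - 1 = (x - 1) + h by ring.
    rewrite !tE; ring.
  apply: mulr_ge0; first by rewrite mulr_ge0 ?powR_ge0 ?expR_ge0.
  by apply: powR_sub_mul_ge0 => //; [exact: ltW|exact: powR_ge0|exact: ltW].
rewrite RintegralB//; last 2 first.
- by apply: iG; lra.
- by apply: iZ; apply: iG; lra.
rewrite RintegralZl//; last by apply: iG; lra.
rewrite !EG; try lra.
(* By the choice of [q], the integral of [G (x + h) x] is 0; what remains is
   [Gamma (y + h) - q * Gamma y >= 0]. *)
rewrite /q divfK ?gt_eqF// subrr mulr0 subr0 subr_ge0 mulrAC ler_pdivrMr//.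
by rewrite mulrC (mulrC (Gamma (y + h))).
Qed.

Lemma Gamma_three_half (R : realType) : Gamma (1 + 2^-1 : R) = Num.sqrt pi / 2.
Proof. by rewrite addrC GammaS// Gamma_half mulrC. Qed.

Lemma sqrt_pi_gt0 (R : realType) : 0 < Num.sqrt (pi : R).
Proof. by rewrite sqrtr_gt0 pi_gt0. Qed.

Lemma critical_alphaE (R : realType) (alpha : R) : 0 < alpha ->
  4 * alpha * Gamma (alpha + 1) = Num.sqrt pi * Gamma (alpha + 2^-1) <->
  alpha = 2^-1.
Proof.
move=> a0.
have half1 : 2^-1 + 2^-1 = 1 :> R by lra.
have [h2 h2' ah1] : [/\ 2^-1 <= 1 :> R, 0 <= 2^-1 :> R &
    2^-1 <= alpha + 2^-1] by split; lra.
have addhh : alpha + 2^-1 + 2^-1 = alpha + 1 by rewrite -addrA half1.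
have small : alpha <= 2^-1 ->
    Gamma (alpha + 1) <= Gamma (alpha + 2^-1) * (Num.sqrt pi / 2).
  move=> ah; have ah2 : alpha + 2^-1 <= 1 by rewrite -[leRHS]half1 lerD2r.
  have := Gamma_mul_le ah1 ah2 h2'.
  by rewrite addhh Gamma_three_half (Gamma1 R) mulr1.
have large : 2^-1 <= alpha ->
    Num.sqrt pi / 2 * Gamma (alpha + 2^-1) <= Gamma (alpha + 1).
  move=> ah; have ah2 : 1 <= alpha + 2^-1 by rewrite -[leLHS]half1 lerD2r.
  have := Gamma_mul_le h2 ah2 h2'.
  by rewrite addhh Gamma1 mul1r Gamma_three_half.
split => [|->]; last first.
  by rewrite (addrC _ 1) Gamma_three_half half1 Gamma1; field.
move: (sqrt_pi_gt0 R) (Gamma_gt0 ah1) small large.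
move: (Gamma (alpha + 1)) (Gamma (alpha + 2^-1)) (Num.sqrt _) => H G s.
clear -a0 => s0 G0 small large E; have sG : 0 < s * G by rewrite mulr_gt0.
(* With [H] compared to [s * G / 2], the equation gives [s * G <= 2 * alpha * (s * G)] below 1/2 and
   the reverse inequality above; both contradict [s * G > 0]. *)
have [ah|ah|//] := ltgtP alpha 2^-1.
- have := small (ltW ah); nra.
- have := large (ltW ah); nra.
Qed.

(** * Coefficients: comparison with alpha = 0 and recurrence *)

Lemma bessel_struve_coef0 (R : realType) (alpha : R) : 0 <= alpha ->
  bessel_struve_coef alpha 0 = 1.
Proof.
move=> a0; have sp := sqrt_pi_gt0 R.
have Ga : 0 < Gamma (alpha + 1) by apply: Gamma_gt0; lra.
rewrite /bessel_struve_coef fact0 mul0r add0r div1r Gamma_half.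
by field; rewrite !gt_eqF.
Qed.

Lemma bessel_struve_coef_ge0 (R : realType) (alpha : R) n : 0 <= alpha ->
  0 <= bessel_struve_coef alpha n.
Proof.
move=> a0; have n0 : 0 <= n%:R :> R by [].
have nS : n.+1%:R = n%:R + 1 :> R by rewrite natr1.
rewrite /bessel_struve_coef divr_ge0 ?mulr_ge0 ?sqrtr_ge0//;
  by apply/ltW/Gamma_gt0; rewrite ?nS; lra.
Qed.

(** Only [Gamma (alpha + 1) / Gamma (n / 2 + alpha + 1)] depends on [alpha]. Log-convexity between 1
    and [alpha + 1] with shift [n / 2] bounds it by its value at 0. *)
Lemma bessel_struve_coef_le (R : realType) (alpha : R) n : 0 <= alpha ->
  bessel_struve_coef alpha n <= bessel_struve_coef 0 n.
Proof.
move=> a0; have n0 : 0 <= n%:R :> R by [].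
have nS : n.+1%:R = n%:R + 1 :> R by rewrite natr1.
have [h1 h2 h3 h4 h5] : [/\ 2^-1 <= n.+1%:R / 2 :> R,
    2^-1 <= n%:R / 2 + alpha + 1, 2^-1 <= 1 + n%:R / 2 :> R,
    2^-1 <= 1 :> R & 1 <= alpha + 1 :> R].
  by rewrite nS; split; lra.
have h6 : 0 <= n%:R / 2 :> R by rewrite divr_ge0.
have := Gamma_mul_le h4 h5 h6; rewrite Gamma1 mul1r.
have -> : alpha + 1 + n%:R / 2 = n%:R / 2 + alpha + 1 by ring.
rewrite /bessel_struve_coef add0r Gamma1 mul1r.
have -> : n%:R / 2 + 0 + 1 = 1 + n%:R / 2 :> R by ring.
have fn : 0 < n`!%:R :> R by rewrite ltr0n fact_gt0.
move: (mulr_gt0 (sqrt_pi_gt0 R) fn) (Gamma_gt0 h1) (Gamma_gt0 h2) (Gamma_gt0 h3).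
move: (_ * n`!%:R) (Gamma (_ / 2)) (Gamma (_ + alpha + 1)) (Gamma (1 + _))
  (Gamma (alpha + 1)) => s g p q r.
clear => s0 g0 p0 q0 qr_le.
rewrite ler_pdivrMr ?mulr_gt0// mulrAC ler_pdivlMr ?mulr_gt0//.
have := ler_wpM2r (mulr_ge0 (ltW g0) (ltW s0)) qr_le; lra.
Qed.

Lemma bessel_struve_coef1 (R : realType) :
  bessel_struve_coef (0 : R) 1 = 2 / pi.
Proof.
have sp := sqrt_pi_gt0 R.
rewrite /bessel_struve_coef (_ : 1`! = 1%N)//.
have -> : 1%:R / 2 + 0 + 1 = 1 + 2^-1 :> R by lra.
have -> : 2%:R / 2 = 1 :> R by rewrite divff.
rewrite Gamma_three_half add0r Gamma1.
rewrite -[in RHS](sqr_sqrtr (pi_ge0 R)).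
by field; rewrite gt_eqF.
Qed.

(** The functional equation contributes [(n + 1) / (n + 2)] and the factorial
    [1 / ((n + 1) * (n + 2))]. *)
Lemma bessel_struve_coefSS (R : realType) n :
  bessel_struve_coef (0 : R) n.+2 =
  bessel_struve_coef (0 : R) n / n.+2%:R ^+ 2.
Proof.
have n0 : 0 <= n%:R :> R by [].
have nS : n.+1%:R = n%:R + 1 :> R by rewrite natr1.
have nSS : n.+2%:R = n%:R + 2 :> R by rewrite -addn2 natrD.
have nSSS : n.+3%:R = n%:R + 3 :> R by rewrite -addn3 natrD.
have [h1 h2] : 2^-1 <= n.+1%:R / 2 :> R /\ 2^-1 <= n%:R / 2 + 0 + 1 :> R.
  by rewrite nS; split; lra.
rewrite /bessel_struve_coef !factS !natrM.
have -> : n.+3%:R / 2 = n.+1%:R / 2 + 1 :> R by rewrite nS nSSS; lra.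
have -> : n.+2%:R / 2 + 0 + 1 = (n%:R / 2 + 0 + 1) + 1 :> R by rewrite nSS; lra.
rewrite (GammaS h1) (GammaS h2) nS nSS.
have fn : 0 < n`!%:R :> R by rewrite ltr0n fact_gt0.
move: n0 fn (sqrt_pi_gt0 R) (Gamma_gt0 h2).
move: (n%:R) (n`!%:R) (Num.sqrt _) (Gamma (_ / 2)) (Gamma (0 + 1))
  (Gamma (_ + 0 + 1)) => m f s g h k.
clear => m0 f0 s0 k0.
by field; rewrite !gt_eqF//; lra.
Qed.

(** * Numerical bounds: pi and the sum of the coefficients at alpha = 0 *)

Lemma sin_le (R : realType) (x : R) : 0 <= x -> sin x <= x.
Proof.
move=> x0.
have ds y : y \in `]0, x[%R -> is_derive y 1 sin (cos y).
  by move=> _; exact: is_derive_sin.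
have cs : {within `[0, x], continuous (@sin R)}.
  by apply: continuous_subspaceT => y; exact: continuous_sin.
have [c _] := MVT_segment x0 ds cs.
by rewrite sin0 !subr0 => ->; rewrite ler_piMl// cos_le1.
Qed.

(* [2 * sin (pi / 8) ^+ 2 = 1 - cos (pi / 4)] and [cos (pi / 4) ^+ 2 = 1 / 2]. *)
Lemma pi_gt_306_100 (R : realType) : 306 / 100 < pi :> R.
Proof.
have p2 := pi_ge2 R; have pl2 := pihalf_lt2 R.
have h : pi / 2 = (pi / 4) *+ 2 :> R by rewrite (mulr2n (pi / 4)); lra.
have h' : pi / 4 = (pi / 8) *+ 2 :> R by rewrite (mulr2n (pi / 8)); lra.
have c2 : cos (pi / 4 : R) ^+ 2 = 1 / 2.
  by have := cos_pihalf R; rewrite h cos_mulr2n (mulr2n (_ ^+ 2)); lra.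
have s8 : cos (pi / 4 : R) = 1 - 2 * sin (pi / 8) ^+ 2.
  by rewrite h' cos_mulr2n cos2sin2 (mulr2n (1 - _)); lra.
have s0 : 0 <= sin (pi / 8 : R) by apply: sin_ge0_pi; lra.
have s1 : sin (pi / 8 : R) <= pi / 8 by apply: sin_le; lra.
move: s0 s1 s8 c2 p2; move: (sin _) (cos _) => s c; move: (pi : R) => p.
clear => s0 s1 -> c2 p2; rewrite ltNge; apply/negP => p_le.
(* Here [153 / 400] is [3.06 / 8]. It forces [1 - 2 * s ^+ 2 > 0.7073], whose square exceeds 1/2. *)
have s38 : s <= 153 / 400 by lra.
have := ler_wpM2l s0 s38; nra.
Qed.

Lemma two_div_pi_lt (R : realType) : 2 / pi < 327 / 500 :> R.
Proof.
have := pi_gt_306_100 R; move: (pi : R) => p p_gt.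
by rewrite ltr_pdivrMr; lra.
Qed.

(** Strengthened induction: from index 5 on, each term is at most 1/25 of the term two places
    earlier, and [1 / 24] is the sum of the powers of [1 / 25] from the first on. *)
Lemma sum_bessel_struve_coef_le (R : realType) N :
  \sum_(i < N) bessel_struve_coef (0 : R) i <= 1997 / 1000.
Proof.
pose b i : R := bessel_struve_coef 0 i.
have b_ge0 i : 0 <= b i by exact: bessel_struve_coef_ge0.
have bSS i : b i.+2 = b i / i.+2%:R ^+ 2 by exact: bessel_struve_coefSS.
(* The tail beyond two consecutive terms is at most [1 / 24] of their sum. *)
have key M : \sum_(i < M + 5) b i + (b (M + 3)%N + b (M + 4)%N) / 24 <= 1997 / 1000.
  elim: M => [|M IHM].
    (* With [r = 2 / pi] the five terms are [1], [r], [1 / 4], [r / 9], [1 / 64]; for [r < 0.654]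
       they and the tail bound stay below 1.996. *)
    rewrite !big_ord_recr big_ord0 /= !bSS /b bessel_struve_coef0// bessel_struve_coef1.
    have := two_div_pi_lt R; move: (2 / pi) => r; clear; lra.
  have le25 : b (M + 5)%N <= b (M + 3)%N / 25.
    rewrite (_ : (M + 5 = (M + 3).+2)%N) ?bSS; last by rewrite !addnS.
    rewrite ler_wpM2l// lef_pV2 ?posrE ?exprn_gt0//.
    by rewrite expr2 (natrM _ 5 5) ler_pM// ler_nat !addnS !ltnS.
  rewrite (addSnnS M 3) (addSnnS M 4) addSn big_ord_recr/=.
  move: le25 IHM; move: (\sum_(i < _) _) (b _) (b _) (b _) => S p q r.
  clear; lra.
apply: le_trans (key N); rewrite big_split_ord/= -addrA lerDl.
by rewrite addr_ge0 ?sumr_ge0// divr_ge0// addr_ge0.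
Qed.

(** * Complex limits by parts, and the real part of the series *)

Lemma cvg_real_complex (R : realType) (u : nat -> R) (l : R) :
  u n @[n --> \oo] --> l -> ((u n)%:C : R[i]^o) @[n --> \oo] --> (l%:C : R[i]^o).
Proof.
move=> /cvgrPdist_lt ul; apply/cvgrPdist_lt => -[r i].
rewrite ltcE/= => /andP[/eqP -> r0]; near=> n.
have -> : l%:C - (u n)%:C = (l - u n)%:C :> R[i] by rewrite rmorphB.
rewrite normc_def/= expr0n addr0 sqrtr_sqr complexr0 ltcR.
by near: n; exact: ul.
Unshelve. all: by end_near. Qed.

Lemma cvg_complex (R : realType) (u : nat -> R[i]) (a b : R) :
  complex.Re (u n) @[n --> \oo] --> a -> complex.Im (u n) @[n --> \oo] --> b ->
  (u n : R[i]^o) @[n --> \oo] --> (a +i* b : R[i]^o).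
Proof.
move=> ua ub; rewrite [a +i* b]complexE/=.
under eq_fun do rewrite [u _]complexE.
apply: (@cvgD R[i] R[i]^o); first exact: cvg_real_complex.
by apply: (@cvgM R[i]); [exact: cvg_cst|exact: cvg_real_complex].
Qed.

Lemma limn_complex (R : realType) (u : nat -> R[i]^o) (a b : R) :
  complex.Re (u n : R[i]) @[n --> \oo] --> a ->
  complex.Im (u n : R[i]) @[n --> \oo] --> b ->
  limn u = a +i* b.
Proof.
move=> ua ub; apply: cvg_lim; last exact: cvg_complex.
exact: norm_hausdorff.
Qed.

Lemma normc_Re_le (R : realType) (z : R[i]) : `|complex.Re z| <= complex.Re `|z|.
Proof. by have := normc_ge_Re z; rewrite lecE/= => /andP[]. Qed.

(** Multiplication by ['i] preserves the modulus and turns the imaginary part, up to sign, into the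
    real part. *)
Lemma normc_Im_le (R : realType) (z : R[i]) : `|complex.Im z| <= complex.Re `|z|.
Proof.
have := normc_Re_le (z * 'i); rewrite ReiNIm normrN normrM.
suff -> : `|'i%C| = 1 :> R[i] by rewrite mulr1.
by rewrite normc_def/= expr0n/= expr1n add0r sqrtr1.
Qed.

Lemma Re_normX_le1 (R : realType) (z : R[i]) n : `|z| < 1 ->
  complex.Re `|z ^+ n| <= 1.
Proof.
move=> z1; have : `|z ^+ n| <= 1 by rewrite normrX exprn_ile1// ltW.
by rewrite lecE => /andP[].
Qed.

(** Absolute convergence: the partial sums of the absolute values increase and are bounded by
    [M]. *)
Lemma cvg_series_bounded_le (R : realType) (u b : nat -> R) (M : R) :
  (forall n, `|u n| <= b n) ->
  (forall n, \sum_(i < n) b i <= M) -> cvgn (series u).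
Proof.
move=> ub bM; apply: normed_cvg.
apply: nondecreasing_is_cvgn.
  by apply: nondecreasing_series => n _ _ /=.
exists M => _ [n _ <-]; rewrite /normed_series_of seriesEord/=.
by apply: le_trans (bM n); apply: ler_sum.
Qed.

Lemma Re_bessel_struve_gt0 (R : realType) (alpha : R) (z : R[i]) :
  0 <= alpha -> `|z| < 1 -> 0 < complex.Re (bessel_struve alpha z).
Proof.
move=> a0 z1.
pose c n : R := bessel_struve_coef alpha n.
pose b n : R := bessel_struve_coef 0 n.
pose x n : R := c n * complex.Re (z ^+ n).
pose y n : R := c n * complex.Im (z ^+ n).
have c_ge0 n : 0 <= c n by exact: bessel_struve_coef_ge0.
have cb n : c n <= b n by exact: bessel_struve_coef_le.
have bound n (r : R) : `|r| <= complex.Re `|z ^+ n| -> `|c n * r| <= b n.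
  move=> h; rewrite normrM ger0_norm//; apply: le_trans (cb n).
  by rewrite ler_piMr// (le_trans h)// Re_normX_le1.
have xb n : `|x n| <= b n by apply: bound; exact: normc_Re_le.
have yb n : `|y n| <= b n by apply: bound; exact: normc_Im_le.
have cx := cvg_series_bounded_le xb (@sum_bessel_struve_coef_le R).
have cy := cvg_series_bounded_le yb (@sum_bessel_struve_coef_le R).
have termE n : (c n)%:C * z ^+ n = x n +i* y n.
  by rewrite /x /y; case: (z ^+ n) => p q; simpc.
pose w n : R[i]^o := (c n)%:C * z ^+ n.
have SE n : (series w n : R[i]) = series x n +i* series y n.
  rewrite !seriesEord /=; elim: n => [|n IHn]; first by rewrite !big_ord0.
  by rewrite !big_ord_recr /= IHn /w termE; simpc.
(* Both real series converge, so the [limn] in the definition is a genuine limit. *)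
have -> : bessel_struve alpha z = limn (series x) +i* limn (series y).
  apply: limn_complex.
    by under eq_fun do rewrite SE /=.
  by under eq_fun do rewrite SE /=.
(* The constant is [2 - 1997 / 1000]: the leading term 1 minus the bound [1997 / 1000 - 1] on the
   others. The index is [n.+1] because the empty partial sum is 0. A uniform bound keeps positivity
   strict in the limit. *)
have low n : 3 / 1000 <= series x n.+1.
  have := @sum_bessel_struve_coef_le R n.+1.
  rewrite seriesEord/= !big_ord_recl.
  have -> : bessel_struve_coef (0 : R) (@ord0 n) = 1 by exact: bessel_struve_coef0.
  have -> : x (@ord0 n) = 1 by rewrite /x /c bessel_struve_coef0// expr0 mul1r.
  have : - \sum_(i < n) b (lift ord0 i) <= \sum_(i < n) x (lift ord0 i).
    rewrite -sumrN; apply: ler_sum => i _.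
    by have := xb (lift ord0 i); rewrite ler_norml => /andP[].
  rewrite /b; move: (\sum_(i < n) _) (\sum_(i < n) _) => p q; clear; lra.
rewrite /=; apply: (@lt_le_trans _ _ (3 / 1000)); first by clear; lra.
apply: limr_ge => //; near=> n.
have n0 : (0 < n)%N by near: n; exact: nbhs_infty_gt.
by rewrite -(prednK n0).
Unshelve. all: by end_near. Qed.

Theorem corollary2p1 (R : realType) :
  let alpha0 : R := 1 / 2 in
  [/\ 0 < alpha0,
      (forall alpha : R, 0 < alpha ->
         (4 * alpha * Gamma (alpha + 1) = Num.sqrt pi * Gamma (alpha + 1 / 2)
          <-> alpha = alpha0))
    & forall alpha : R, 0 <= alpha <= alpha0 \/ 3 / 2 <= alpha ->
      forall z : complex R, `|z| < 1 ->
        0 < complex.Re (bessel_struve alpha z)].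
Proof.
rewrite div1r; split=> [|alpha|alpha h z z1].
- by rewrite invr_gt0.
- exact: critical_alphaE.
- by apply: Re_bessel_struve_gt0 => //; case: h => [/andP[]|]//; lra.
Qed.
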